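(* Let $A$ be a quasinormable Fréchet-Arens-Michael algebra with a right locally bounded approximate identity. Then $A$ has a right bounded approximate identity.
   Context: A Fréchet-Arens-Michael algebra is a (complex) Fréchet algebra whose topology is given by a family of submultiplicative seminorms ($\|ab\|\le\|a\|\|b\|$). A Hausdorff locally convex space $E$ is quasinormable if for each $0$-neighborhood $U\subset E$ there exists a $0$-neighborhood $V\subset U$ such that for each $\varepsilon>0$ there exists a bounded set $S\subset E$ with $V\subset S+\varepsilon U$. A topological algebra $A$ has a right locally bounded approximate identity if for each $0$-neighborhood $U\subset A$ there exists $C>0$ such that for each finite subset $F\subset A$ there exists $b\in CU$ with $a-ab\in U$ for all $a\in F$. A right bounded approximate identity in $A$ is a net $(e_\alpha)$ such that the set $\{e_\alpha\}$ is bounded and $ae_\alpha\to a$ for each $a\in A$. *)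

(* Defs.v *)
From HB Require Import structures.
From mathcomp Require Import all_boot all_order all_algebra.
From mathcomp Require Import all_classical all_reals all_analysis.
From mathcomp Require Export complex.

Set Implicit Arguments.
Unset Strict Implicit.
Unset Printing Implicit Defensive.

Import Order.TTheory GRing.Theory Num.Theory.
Import numFieldNormedType.Exports.

Local Open Scope classical_set_scope.
Local Open Scope ring_scope.
Local Open Scope complex_scope.

Section LocallyConvexSpaces.
Context (R : realType) (E : tvsType R[i]).

(* The metric is only required to induce the topology. *)
Definition metrizable : Prop :=
  exists d : E -> E -> R,
    [/\ forall x y, (d x y = 0) <-> (x = y),
        forall x y, d x y = d y x,
        forall x y z, d x z <= d x y + d y z
      & forall x, nbhs x =
          filter_from [set e : R | 0 < e] (fun e => [set y | d x y < e])].

(* [tvsType] does not relate the uniform structure to the vector space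
   structure (it only has to induce the topology).  Uniform continuity of the
   addition says that it is the uniformity of the topological group [(E, +)],
   so that [cauchy] has its usual meaning in a topological vector space. *)
Definition additive_uniformity : Prop :=
  unif_continuous (fun x : E * E => x.1 + x.2).

Definition complete_space : Prop :=
  forall F : set_system E, ProperFilter F -> cauchy F ->
    exists l : E, F --> l.

Record frechet_space : Prop := {
  frechet_additive : additive_uniformity;
  frechet_metrizable : metrizable;
  frechet_complete : complete_space
}.

Definition seminorm (p : E -> R) : Prop :=
  (forall x y, p (x + y) <= p x + p y) /\
  (forall (z : R[i]) x, (p (z *: x))%:C = `|z| * (p x)%:C).

Definition generated_by_seminorms (P : set (E -> R)) : Prop :=
  forall (x : E) (U : set E), nbhs x U <->
    exists (Q : set (E -> R)) (e : R),
      [/\ finite_set Q, Q `<=` P, 0 < e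
        & [set y | forall p, Q p -> p (y - x) < e] `<=` U].

Definition dilate (z : R[i]) (U : set E) : set E := ( *:%R z) @` U.

(* von Neumann boundedness; the library's [bounded_set] is for normed spaces *)
Definition vn_bounded (S : set E) : Prop :=
  forall U : set E, nbhs 0 U ->
    exists2 r : R, 0 < r & forall z : R[i], r%:C <= `|z| -> S `<=` dilate z U.

Definition quasinormable : Prop :=
  hausdorff_space E /\
  forall U : set E, nbhs 0 U ->
    exists V : set E, [/\ nbhs 0 V, V `<=` U &
      forall e : R, 0 < e ->
        exists2 S : set E, vn_bounded S &
          V `<=` [set s + v | s in S & v in dilate e%:C U]].

End LocallyConvexSpaces.

(* Nets: [le] directs the index type [I], and a net [x : I -> T] converges to
   [l] when [x @ net_filter le --> l]. *)
Definition directed (I : Type) (le : I -> I -> Prop) : Prop :=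
  [/\ exists i : I, True,
      forall i, le i i,
      forall i j k, le i j -> le j k -> le i k
    & forall i j, exists2 k, le i k & le j k].

Definition net_filter (I : Type) (le : I -> I -> Prop) : set_system I :=
  filter_from [set: I] (fun i => [set j | le i j]).

(* Algebras are not assumed to be unital, hence the product is an explicit
   operation instead of the one of a ring structure. *)
Section TopologicalAlgebras.
Context (R : realType) (A : tvsType R[i]) (mul : A -> A -> A).

Record algebra_law : Prop := {
  algebra_mulA : associative mul;
  algebra_mulDl : left_distributive mul +%R;
  algebra_mulDr : right_distributive mul +%R;
  algebra_scaleAl : forall (z : R[i]) x y, mul (z *: x) y = z *: mul x y;
  algebra_scaleAr : forall (z : R[i]) x y, mul x (z *: y) = z *: mul x y
}.

Record frechet_algebra : Prop := {
  frechet_algebra_space : frechet_space A;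
  frechet_algebra_law : algebra_law;
  frechet_algebra_continuous : continuous (fun xy : A * A => mul xy.1 xy.2)
}.

Definition frechet_arens_michael : Prop :=
  frechet_algebra /\
  exists P : set (A -> R),
    [/\ forall p, P p -> seminorm p,
        forall p, P p -> forall a b, p (mul a b) <= p a * p b
      & generated_by_seminorms P].

Definition right_locally_bounded_approximate_identity : Prop :=
  forall U : set A, nbhs 0 U ->
    exists2 C : R, 0 < C &
      forall F : set A, finite_set F ->
        exists2 b : A, dilate C%:C U b & forall a, F a -> U (a - mul a b).

Definition right_bounded_approximate_identity : Prop :=
  exists (I : Type) (le : I -> I -> Prop) (e : I -> A),
    [/\ directed le, vn_bounded (range e)
      & forall a : A, mul a (e i) @[i --> net_filter le] --> a].

End TopologicalAlgebras.

(* Main.v *)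
(** Let q_0 <= q_1 <= ... be submultiplicative seminorms defining the topology,
    chosen so that by quasinormability a set bounded for q_(n+1) lies within
    any eps > 0, for q_n, of a bounded set.  Suppose that b almost fixes, for
    q_(n+1) and under multiplication from the right, a finite set.  Replace b
    by a q_n-close s in a bounded set that depends only on n, and then s by
    e + s - es, where e almost fixes a given F for q_(n+2).  Then
      a - a(e + s - es) = (a - ae) - (a - ae)s
    is q_(n+2)-small for a in F, whereas
      (e + s - es) - s = (e - eb) + e(b - s)
    is q_n-small provided that b was chosen, after e, so as to almost fix e.
    Hence at each level n there are elements that almost fix F and whose
    q_0, ..., q_(n+1) are bounded by constants independent of F and n.  Such an
    element is corrected to one that is bounded for all q_k by iterating
    b |-> s alone and passing to the limit: F is fixed by then, so a correction
    that starts at a large enough level does no harm. *)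

Require Import Defs.
From mathcomp Require Import all_boot all_order all_algebra.
From mathcomp Require Import all_classical all_reals all_analysis.
From mathcomp Require Import ring lra.

Set Implicit Arguments.
Unset Strict Implicit.
Unset Printing Implicit Defensive.

Import Order.TTheory GRing.Theory Num.Theory.
Import numFieldNormedType.Exports.

Local Open Scope classical_set_scope.
Local Open Scope ring_scope.
Local Open Scope complex_scope.

(** * Seminorm calculus over the complex numbers *)

Section Seminorm.
Context (R : realType) (E : tvsType R[i]) (p : E -> R) (sp : seminorm p).

Lemma seminormD x y : p (x + y) <= p x + p y.
Proof. by case: sp. Qed.

(** The norm of [R[i]] takes values in [R[i]], so its real part serves as the real modulus. *)
Lemma seminormZ z x : p (z *: x) = complex.Re `|z| * p x.
Proof.
case: sp => _ /(_ z x); rewrite -{1}(RRe_real (normr_real z)) -rmorphM.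
exact: complexI.
Qed.

Lemma seminormZr t x : 0 <= t -> p (t%:C *: x) = t * p x.
Proof. by move=> t0; rewrite seminormZ ger0_norm ?lecR. Qed.

Lemma seminorm0 : p 0 = 0.
Proof. by rewrite -(scale0r 0) -[0 : R[i]]/(0%:C) seminormZr // mul0r. Qed.

Lemma seminormN x : p (- x) = p x.
Proof. by rewrite -scaleN1r seminormZ normrN1 mul1r. Qed.

Lemma seminormB x y : p (x - y) <= p x + p y.
Proof. by rewrite -(seminormN y) seminormD. Qed.

Lemma seminorm_distC x y : p (x - y) = p (y - x).
Proof. by rewrite -seminormN opprB. Qed.

Lemma seminorm_ge0 x : 0 <= p x.
Proof.
by have := seminormD x (- x); rewrite subrr seminorm0 seminormN; lra.
Qed.

Lemma seminorm_dist x y z : p (x - z) <= p (x - y) + p (y - z).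
Proof. by rewrite -(subrKA y) seminormD. Qed.

Lemma seminorm_le_dist x y : p x <= p y + p (x - y).
Proof. by rewrite addrC -{1}(subrK y x) seminormD. Qed.

End Seminorm.


(** * Increasing sequences of seminorms *)

Section IncreasingSeminorms.
Context (R : realType) (T : Type) (q : nat -> T -> R).
Hypothesis q_leS : forall n x, q n x <= q n.+1 x.

Lemma increasing_le m n x : (m <= n)%N -> q m x <= q n x.
Proof. exact: ((nondecreasing_seqP (fun k => q k x)).1 (q_leS^~ x)). Qed.

End IncreasingSeminorms.

(** * Seminorms, neighborhoods and the uniformity *)

Section Topology.
Context (R : realType) (A : tvsType R[i]) (mul : A -> A -> A).

Record continuous_submult_seminorm (q : A -> R) : Prop := {
  css_seminorm : seminorm q;
  css_submult : forall a b, q (mul a b) <= q a * q b;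
  css_nbhs : forall x e, 0 < e -> nbhs x [set y | q (y - x) < e]
}.

Lemma css_nbhs0 q e : continuous_submult_seminorm q -> 0 < e ->
  nbhs 0 [set y | q y < e].
Proof.
by move=> qc /(css_nbhs qc 0); under eq_fun do rewrite subr0.
Qed.

Lemma css0 : continuous_submult_seminorm (fun=> 0).
Proof.
split=> [|*|x e e0]; first by split=> *; rewrite ?addr0 ?mulr0.
  by rewrite mulr0.
by apply: filterS filterT => y _.
Qed.

Lemma css_max p q : continuous_submult_seminorm p ->
  continuous_submult_seminorm q ->
  continuous_submult_seminorm (fun x => Num.max (p x) (q x)).
Proof.
move=> pc qc; have [ps qs] := (css_seminorm pc, css_seminorm qc).
split=> [|a b|x e e0].
- split=> [x y|z x].
    rewrite ge_max; apply/andP; split.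
      apply: le_trans (seminormD ps x y) _.
      by rewrite lerD // le_max lexx.
    apply: le_trans (seminormD qs x y) _.
    by rewrite lerD // le_max lexx orbT.
  have z0 : 0 <= complex.Re `|z|.
    by rewrite -lecR (RRe_real (normr_real z)) normr_ge0.
  rewrite !seminormZ // -maxr_pMr // rmorphM.
  by rewrite -[in RHS](RRe_real (normr_real z)).
- rewrite ge_max; apply/andP; split.
    apply: le_trans (css_submult pc a b) _.
    by rewrite ler_pM ?seminorm_ge0 // le_max lexx.
  apply: le_trans (css_submult qc a b) _.
  by rewrite ler_pM ?seminorm_ge0 // le_max lexx orbT.
- apply: filterS (filterI (css_nbhs pc x e0) (css_nbhs qc x e0)) => y [/= py qy].
  by rewrite gt_max py.
Qed.

(** A maximum of finitely many continuous submultiplicative seminorms is again one, so a single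
    seminorm replaces the finite family of a basic neighborhood. *)
Lemma generated_basis (P : set (A -> R)) :
  (forall p, P p -> seminorm p) ->
  (forall p, P p -> forall a b, p (mul a b) <= p a * p b) ->
  generated_by_seminorms P ->
  forall W : set A, nbhs 0 W -> exists2 q, continuous_submult_seminorm q &
    exists2 e, 0 < e & [set y | q y < e] `<=` W.
Proof.
move=> PS PM PG W /PG[Q [e [/finite_seqP[s ->{Q}] sP e0 sW]]].
have Pcss p : P p -> continuous_submult_seminorm p.
  move=> Pp; split; [exact: PS | exact: PM | move=> x d d0].
  apply/PG; exists [set p], d; split=> //; first by move=> _ ->.
  by move=> y /(_ p erefl).
suff [q qc qs] : exists2 q, continuous_submult_seminorm q &
    forall p, p \in s -> forall x, p x <= q x.
  exists q => //; exists e => // y /= qy; apply: sW => p /= ps.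
  by rewrite subr0 (le_lt_trans (qs p ps y)).
elim: s sP {sW} => [|p s IH] sP; first by exists (fun=> 0); first exact: css0.
have [|q qc qs] := IH; first by move=> p' /= p's; apply: sP; rewrite /= inE p's orbT.
exists (fun x => Num.max (p x) (q x)).
  by apply: css_max qc; apply/Pcss/sP; rewrite /= mem_head.
move=> p'; rewrite inE => /predU1P[-> x|/qs p'q x]; rewrite le_max ?lexx //.
by rewrite p'q orbT.
Qed.

Lemma nbhs_translate (P : set (A -> R)) (x : A) (U : set A) :
  generated_by_seminorms P -> nbhs x U -> nbhs 0 [set z | U (x + z)].
Proof.
move=> PG /PG[Q [e [Qf QP e0 QU]]]; apply/PG; exists Q, e; split=> // z /= Qz.
by apply: QU => p /Qz; rewrite subr0 addrC addKr.
Qed.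

Lemma vn_bounded_seminorm q (S : set A) : continuous_submult_seminorm q ->
  vn_bounded S -> exists2 M, 0 < M & forall s, S s -> q s <= M.
Proof.
move=> qc Sb; have [r r0 /(_ r%:C)] := Sb _ (css_nbhs0 qc ltr01).
rewrite ger0_norm ?lecR ?(ltW r0) ?lexx // => /(_ isT) Sr.
exists r => // s /Sr[y /= qy <-].
by rewrite (seminormZr (css_seminorm qc)) ?ler_piMr ?ltW.
Qed.

(** The points (y, 0) and (y, u) are close uniformly in y, hence so are their sums y and y + u. This
    reduces the Cauchy condition to neighborhoods of 0. *)
Lemma additive_uniformity_nbhs (E : set (A * A)) : additive_uniformity A ->
  entourage E -> nbhs 0 [set u | forall y, E (y, y + u)].
Proof.
move=> aU /aU [[B1 B2] [/= B1e B2e] sB].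
apply: filterS (nbhs_entourage 0 B2e) => u /xsectionP B2u y.
have [|[[a b] [c d]] /= Eabcd [ay cy b0 du]] := sB ((y, y), (0, u)).
  by split=> //=; exact: entourage_refl.
by move: Eabcd; rewrite ay cy b0 du addr0.
Qed.

End Topology.

(** * A defining sequence of seminorms adapted to quasinormability *)

Section QuasinormableBasis.
Context (R : realType) (A : tvsType R[i]) (mul : A -> A -> A).

Lemma quasinormable_lift (q : A -> R) :
  continuous_submult_seminorm mul q -> quasinormable A ->
  exists2 V : set A, nbhs 0 V & forall eps, 0 < eps ->
    exists2 S : set A, vn_bounded S &
      forall b, V b -> exists2 s, S s & q (b - s) <= eps.
Proof.
move=> qc [_ qn]; have [V [V0 _ VS]] := qn _ (css_nbhs0 qc ltr01).
exists V => // eps eps0; have [S Sb SV] := VS eps eps0; exists S => // b /SV.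
case=> s Ss [_ [v /= qv <-] <-]; exists s => //.
rewrite addrAC subrr add0r (seminormZr (css_seminorm qc)) ?ler_piMr ?ltW //.
Qed.

(** Each new seminorm dominates [q n] and has a small ball inside both the set [V] that
    quasinormability gives for [q n] and the metric ball of radius 1/(n+1). The metric balls make
    the sequence define the topology; scaling passes from the small ball to every radius [r]. *)
Lemma quasinormable_basis : frechet_arens_michael mul -> quasinormable A ->
  exists q : nat -> A -> R,
    [/\ forall n, continuous_submult_seminorm mul (q n),
        forall n x, q n x <= q n.+1 x,
        forall W : set A, nbhs 0 W ->
          exists n, exists2 e, 0 < e & [set y | q n y < e] `<=` W
      & forall n r eps, 0 < eps -> exists2 M, 0 < M &
          forall b, q n.+1 b <= r ->
            exists2 s, q n.+2 s <= M & q n (b - s) <= eps].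
Proof.
move=> [[[_ [d [_ _ _ dN]] _] law _] [P [PS PM PG]]] hq.
pose ball n := [set y : A | d 0 y < n.+1%:R^-1].
have ball0 n : nbhs 0 (ball n).
  by rewrite dN; exists n.+1%:R^-1 => //=; rewrite invr_gt0.
pose css := {q : A -> R | continuous_submult_seminorm mul q}.
have /choice[nxt nxtP] (nq : nat * css) : exists q' : css,
    [/\ forall x, sval nq.2 x <= sval q' x,
        exists2 e, 0 < e & [set y | sval q' y < e] `<=` ball nq.1
      & exists2 e, 0 < e & forall eps, 0 < eps ->
          exists2 S : set A, vn_bounded S & forall b, sval q' b < e ->
            exists2 s, S s & sval nq.2 (b - s) <= eps].
  case: nq => n [q qc] /=.
  have [V V0 VS] := quasinormable_lift qc hq.
  have [p pc [e e0 pe]] := generated_basis PS PM PG (filterI (ball0 n) V0).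
  exists (exist _ _ (css_max qc pc)); split=> /= [x||].
  - by rewrite le_max lexx.
  - by exists e => // y /=; rewrite gt_max => /andP[_ /pe[]].
  exists e => // eps /VS[S Sb SV]; exists S => // b.
  by rewrite gt_max => /andP[_ /pe[_ /SV]].
pose qs := fix qs n : css :=
  if n is m.+1 then nxt (m, qs m) else exist _ _ (css0 mul).
have qsP n := nxtP (n, qs n).
have qc n : continuous_submult_seminorm mul (sval (qs n)) := svalP (qs n).
exists (fun n => sval (qs n)); split=> // [n x|W|n r eps eps0].
- by case: (qsP n) => /(_ x).
- rewrite dN => -[e /= e0 eW].
  have [N _ NP] := near_infty_natSinv_lt (PosNum e0).
  have [_ [e' e'0 e'b] _] := qsP N; exists N.+1, e' => // y /e'b /= yb.
  by apply: eW; apply: lt_trans yb (NP _ (leqnn N)).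
have [_ _ [e e0 eS]] := qsP n.
have qss k := css_seminorm (qc k).
(* Scaling by [t] moves the [r]-ball into the small ball, and accuracy [t * eps] there becomes [eps]
   after scaling back. Since [r] may be zero or negative, [t] is built from [|r| + 1]. *)
have [t t0 tr] : exists2 t, 0 < t & t * r < e.
  exists (e / (`|r| + 1)); first by rewrite divr_gt0 // ltr_wpDl.
  rewrite mulrAC ltr_pdivrMr ?ltr_wpDl // ltr_pM2l //.
  by have := ler_norm r; lra.
have [S Sb SP] := eS _ (mulr_gt0 t0 eps0).
have [M M0 MP] := vn_bounded_seminorm (qc n.+2) Sb.
exists (t^-1 * M); first by rewrite mulr_gt0 ?invr_gt0.
have tV0 : 0 <= t^-1 by rewrite invr_ge0 ltW.
move=> b br; have tb : sval (qs n.+1) (t%:C *: b) < e.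
  rewrite (seminormZr (qss n.+1)) ?(ltW t0) //; apply: le_lt_trans tr.
  by rewrite ler_pM2l.
have [s Ss sb] := SP _ tb.
exists (t^-1%:C *: s).
  by rewrite seminormZr // ler_pM2l ?invr_gt0 // MP.
have -> : b - t^-1%:C *: s = t^-1%:C *: (t%:C *: b - s).
  rewrite scalerBr scalerA -rmorphM mulVf ?gt_eqF //.
  by rewrite scale1r.
by rewrite seminormZr // ler_pdivrMl.
Qed.

End QuasinormableBasis.

(** * Boundedness, approximate units and limits in terms of the seminorms *)

Section SeminormBasis.
Context (R : realType) (A : tvsType R[i]) (mul : A -> A -> A).
Context (q : nat -> A -> R).
Hypothesis qc : forall n, continuous_submult_seminorm mul (q n).
Hypothesis q_leS : forall n x, q n x <= q n.+1 x.
Hypothesis q_basis : forall W : set A, nbhs 0 W ->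
  exists n, exists2 e, 0 < e & [set y | q n y < e] `<=` W.

Let qS n : seminorm (q n). Proof. exact: css_seminorm (qc n). Qed.

Lemma vn_bounded_basis (K : nat -> R) (S : set A) :
  (forall s k, S s -> q k s <= K k) -> vn_bounded S.
Proof.
move=> SK U /q_basis[n [e e0 eU]].
exists ((`|K n| + 1) / e) => [|z rz x Sx]; first by rewrite divr_gt0 // ltr_wpDl.
have rz' : (`|K n| + 1) / e <= complex.Re `|z|.
  by rewrite -lecR (RRe_real (normr_real z)).
have zr0 : 0 < complex.Re `|z|.
  by apply: lt_le_trans rz'; rewrite divr_gt0 // ltr_wpDl.
have z0 : z != 0 by apply: contraTneq zr0 => ->; rewrite normr0 ltxx.
exists (z^-1 *: x); last by rewrite scalerA divff // scale1r.
apply: eU => /=.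
have -> : q n (z^-1 *: x) = (complex.Re `|z|)^-1 * q n x.
  apply: (mulfI (lt0r_neq0 zr0)); rewrite mulVKf ?gt_eqF // -seminormZ //.
  by rewrite scalerA divff // scale1r.
rewrite ltr_pdivrMl //; apply: le_lt_trans (SK x n Sx) _.
have : (`|K n| + 1) / e * e <= complex.Re `|z| * e by rewrite ler_pM2r.
rewrite divfK ?gt_eqF //; have := ler_norm (K n); lra.
Qed.

(** The definition gives tolerance 1 on the unit ball of [q n]; applying it to [F] scaled by 1/d
    yields tolerance [d] with the same [C]. *)
Lemma approx_unit_basis : algebra_law mul ->
  right_locally_bounded_approximate_identity mul ->
  forall n, exists2 C, 0 < C & forall (F : seq A) d, 0 < d ->
    exists2 b, q n b <= C & {in F, forall a, q n (a - mul a b) <= d}.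
Proof.
move=> law hb n; have [C C0 CP] := hb _ (css_nbhs0 (qc n) ltr01).
exists C => // F d d0; have dV0 : 0 <= d^-1 by rewrite invr_ge0 ltW.
have [_ [b /= qb <-] bF] := CP _ (finite_seq [seq d^-1%:C *: a | a <- F]).
exists (C%:C *: b); first by rewrite seminormZr ?ler_piMr ?ltW.
move=> a aF; have /bF /= := map_f (fun a => d^-1%:C *: a) aF.
rewrite (algebra_scaleAl law) -scalerBr seminormZr // => /ltW.
by rewrite ler_pdivrMl // mulr1.
Qed.

(** As the seminorms increase, every later step is also small in [q m], and the tails are dominated
    by a geometric series. Convergence is expressed by seminorms alone, which is the form used to
    bound the limit. *)
Lemma geometric_limit : frechet_space A -> forall u : nat -> A,
  (forall m, q m (u m.+1 - u m) <= 2^-1 ^+ m.+1) ->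
  exists l, forall n e, 0 < e -> exists m0, forall m, (m0 <= m)%N ->
    q n (u m - l) < e.
Proof.
move=> [aU _ comp] u u_le.
have tail m k : q m (u (m + k)%N - u m) <= 2^-1 ^+ m - 2^-1 ^+ (m + k).
  elim: k => [|k IH]; first by rewrite addn0 !subrr seminorm0.
  have := seminorm_dist (qS m) (u (m + k.+1)%N) (u (m + k)%N) (u m).
  have := le_trans (increasing_le q_leS _ (leq_addr k m)) (u_le (m + k)%N).
  by rewrite addnS exprS; move: IH; lra.
have tail' m k : q m (u (m + k)%N - u m) <= 2^-1 ^+ m.
  apply: le_trans (tail m k) _; rewrite gerBl.
  by rewrite exprn_ge0 // invr_ge0.
have /comp[l ul] : cauchy (u @ \oo).
  move=> E /(additive_uniformity_nbhs aU)/q_basis[n [e e0 eE]].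
  have [N _ NP] := near_infty_natSinv_expn_lt (PosNum (divr_gt0 e0 (ltr0Sn R 1))).
  pose m := maxn n N.
  have near_m i : (m <= i)%N -> q n (u i - u m) < e / 2.
    move=> mi; rewrite -(subnKC mi).
    apply: le_lt_trans (increasing_le q_leS _ (leq_maxl n N)) _.
    apply: le_lt_trans (tail' _ _) _.
    by have := NP m (leq_maxr n N); rewrite /= exprVn div1r.
  exists (u @` [set i | (m <= i)%N], u @` [set i | (m <= i)%N]).
    by split; exists m => // i /= mi; exists i.
  move=> [_ _] /= [[i /= mi <-] [j /= mj <-]].
  rewrite -[u j](subrK (u i)) addrC; apply: eE => /=.
  have := seminorm_dist (qS n) (u j) (u m) (u i).
  rewrite (seminorm_distC (qS n) (u m)).
  by move: (near_m i mi) (near_m j mj); lra.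
exists l => n e e0; have [m0 _ m0P] := ul _ (css_nbhs (qc n) l e0).
by exists m0.
Qed.

End SeminormBasis.

(** * Identities for the circle product e + s - es *)

Section AlgebraLaw.
Context (R : realType) (A : tvsType R[i]) (mul : A -> A -> A).
Hypothesis law : algebra_law mul.

Lemma algebra_mulBl x y z : mul (x - y) z = mul x z - mul y z.
Proof.
by rewrite (algebra_mulDl law) -scaleN1r (algebra_scaleAl law) scaleN1r.
Qed.

Lemma algebra_mulBr x y z : mul x (y - z) = mul x y - mul x z.
Proof.
by rewrite (algebra_mulDr law) -scaleN1r (algebra_scaleAr law) scaleN1r.
Qed.

(** With a formal unit this is 1 - (e + s - es) = (1 - e)(1 - s), multiplied by a from the left. *)
Lemma sub_mul_circ a e s :
  a - mul a (e + s - mul e s) = (a - mul a e) - mul (a - mul a e) s.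
Proof.
rewrite algebra_mulBr (algebra_mulDr law) (algebra_mulA law) algebra_mulBl.
by rewrite !opprD !opprK !addrA.
Qed.

Lemma circ_sub e s b :
  (e + s - mul e s) - s = (e - mul e b) + mul e (b - s).
Proof. by rewrite algebra_mulBr addrA subrK addrAC addrK. Qed.

End AlgebraLaw.

(** * Approximate units with bounds common to all finite sets *)

Section CommonBound.
Context (R : realType) (A : tvsType R[i]) (mul : A -> A -> A).
Context (q : nat -> A -> R).
Hypothesis law : algebra_law mul.
Hypothesis qS : forall n, seminorm (q n).
Hypothesis qM : forall n a b, q n (mul a b) <= q n a * q n b.
Hypothesis q_leS : forall n x, q n x <= q n.+1 x.
Hypothesis q_lift : forall n r eps, 0 < eps -> exists2 M, 0 < M &
  forall b, q n.+1 b <= r -> exists2 s, q n.+2 s <= M & q n (b - s) <= eps.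
Hypothesis q_unit : forall n, exists2 C, 0 < C &
  forall (F : seq A) d, 0 < d ->
    exists2 b, q n b <= C & {in F, forall a, q n (a - mul a b) <= d}.
Hypothesis q_lim : forall u : nat -> A,
  (forall m, q m (u m.+1 - u m) <= 2^-1 ^+ m.+1) ->
  exists l, forall n e, 0 < e -> exists m0, forall m, (m0 <= m)%N ->
    q n (u m - l) < e.

Let h n : R := 2^-1 ^+ n.

Let h_gt0 n : 0 < h n. Proof. by rewrite exprn_gt0. Qed.

Let hS n : h n = h n.+1 + h n.+1.
Proof. by rewrite /h exprS; lra. Qed.

Let h_le m n : (m <= n)%N -> h n <= h m.
Proof. by apply: ler_wiXn2l; lra. Qed.

Let h_small e : 0 < e -> exists n0, forall n, (n0 <= n)%N -> h n < e.
Proof.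
move=> e0; have [n0 _ n0P] := near_infty_natSinv_expn_lt (PosNum e0).
by exists n0 => n /n0P /=; rewrite /h exprVn div1r.
Qed.

(** The bound [K n] is imposed one index higher, on [q n.+1]. The slack 1 - 2^-n grows by 2^-(n+1),
    the size of a correction, from level n to n + 1 and stays below 1. *)
Let partial (K : nat -> R) n b := q n.+1 b <= K n /\
  forall k, (k <= n)%N -> q k b <= K k + 1 - h n.

(** [K] is built from the constants of [q_unit] and [q_lift] only, before any [F] is given. The
    first claim goes up one level by e + s - es, the second by s alone. *)
Lemma partial_bounds : exists K,
  (forall n (F : seq A) d, 0 < d -> exists2 b, partial K n b &
     {in F, forall a, q n.+1 (a - mul a b) <= d}) /\
  (forall n b, partial K n b ->
     exists2 s, partial K n.+1 s & q n (s - b) <= h n.+1).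
Proof.
pose C n := s2val (cid2 (q_unit n.+1)).
have C0 n : 0 < C n := s2valP (cid2 (q_unit n.+1)).
have CP n : forall (F : seq A) d, 0 < d ->
    exists2 b, q n.+1 b <= C n & {in F, forall a, q n.+1 (a - mul a b) <= d}.
  exact: (s2valP' (cid2 (q_unit n.+1))).
(* The terms b - s and e(b - s) together use half of the allowed 2^-(n+1); the other half is kept
   for e - eb. *)
have [eps eps0 epsE] : exists2 eps, forall n, 0 < eps n &
    forall n, eps n + C n.+1 * eps n = h n.+1 / 2.
  exists (fun n => h n.+1 / (2 * (1 + C n.+1))) => n.
    by rewrite divr_gt0 ?h_gt0 // mulr_gt0 // addr_gt0.
  by field; rewrite gt_eqF // addr_gt0.
pose M n r := s2val (cid2 (q_lift n r (eps0 n))).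
have M0 n r : 0 < M n r := s2valP (cid2 (q_lift n r (eps0 n))).
have MP n r : forall b, q n.+1 b <= r ->
    exists2 s, q n.+2 s <= M n r & q n (b - s) <= eps n.
  exact: (s2valP' (cid2 (q_lift n r (eps0 n)))).
(* The bracket bounds [q m.+2] of e + s - es when e is bounded by [C m.+1] and s by [M m (K m)]. *)
pose K := fix K n := if n is m.+1 then
  K m + (C n + M m (K m) + C n * M m (K m)) else C 0.
have KS n : K n.+1 = K n + (C n.+1 + M n (K n) + C n.+1 * M n (K n)) by [].
have K_0 : K 0 = C 0 by [].
clearbody K M C.
have CM0 n r : 0 < C n.+1 * M n r by rewrite mulr_gt0.
have K0 n : 0 < K n.
  elim: n => [|n IH]; first by rewrite K_0.
  by rewrite KS; move: (C0 n.+1) (M0 n (K n)) (CM0 n (K n)); lra.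
(* Index n + 1 is covered by the bound on [q n.+2 s]; smaller indices lose 2^-(n+1) = 2^-n -
   2^-(n+1), which the slack absorbs. *)
have step n b s : partial K n b -> q n.+2 s <= K n.+1 -> q n (s - b) <= h n.+1 ->
    partial K n.+1 s.
  move=> [_ bK] sK sb; split=> // k; rewrite leq_eqVlt => /predU1P[->|].
    apply: le_trans (q_leS _ _) _; apply: le_trans sK _.
    by have := h_le (leq0n n.+1); rewrite [h 0]expr0; lra.
  rewrite ltnS => kn; have := seminorm_le_dist (qS k) s b.
  by move: (bK _ kn) (le_trans (increasing_le q_leS _ kn) sb) (hS n); lra.
exists K; split=> [|n b bP].
  elim=> [|n IH] F d d0.
    have [b bC bF] := CP 0%N F d d0; exists b => //; split=> [|k]; first by rewrite K_0.
    rewrite leqn0 => /eqP ->; rewrite K_0 [h 0]expr0 addrK.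
    exact: le_trans (q_leS _ _) bC.
  (* The two summands pay for a - ae and (a - ae)s. *)
  have [d' d'0 dE] : exists2 d', 0 < d' & d' + d' * M n (K n) = d.
    exists (d / (1 + M n (K n))); first by rewrite divr_gt0 // addr_gt0.
    by field; rewrite gt_eqF // addr_gt0.
  have [e eC eF] := CP n.+1 F d' d'0.
  (* The induction hypothesis is applied to the list of [e] alone: [b] need not fix [F], as [e]
     takes care of it. *)
  have [b bP be] := IH [:: e] (h n.+1 / 2) (divr_gt0 (h_gt0 _) (ltr0Sn _ _)).
  have [bK _] := bP; have [s sM bs] := MP n (K n) b bK.
  exists (e + s - mul e s); last first.
    move=> a /eF ae; rewrite (sub_mul_circ law).
    apply: le_trans (seminormB _ _ _) _ => //.
    have := le_trans (qM _ _ s) (ler_pM (seminorm_ge0 (qS _) _)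
      (seminorm_ge0 (qS _) _) ae sM).
    by move: ae; lra.
  apply: step bP _ _.
    apply: le_trans (seminormB _ _ _) _ => //; rewrite KS.
    have := le_trans (qM _ e s) (ler_pM (seminorm_ge0 (qS _) _)
      (seminorm_ge0 (qS _) _) eC sM).
    by move: (seminormD (qS n.+2) e s) (K0 n); lra.
  have -> : e + s - mul e s - b = (e - mul e b) + mul e (b - s) - (b - s).
    by rewrite -(circ_sub law) opprB addrA subrK.
  apply: le_trans (seminormB _ _ _) _ => //.
  have eb : q n (e - mul e b) <= h n.+1 / 2.
    by apply: le_trans (q_leS _ _) _; apply: be; rewrite mem_head.
  have e_bs := le_trans (qM _ e (b - s)) (ler_pM (seminorm_ge0 (qS _) _)
    (seminorm_ge0 (qS _) _) (le_trans (increasing_le q_leS e (leqW (leqnSn n))) eC) bs).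
  by move: (seminormD (qS n) (e - mul e b) (mul e (b - s))) (epsE n); lra.
have [bK _] := bP; have [s sM bs] := MP n (K n) b bK.
have sb : q n (s - b) <= h n.+1.
  rewrite seminorm_distC //; apply: le_trans bs _.
  have := epsE n; have : 0 < C n.+1 * eps n by rewrite mulr_gt0.
  by have := h_gt0 n.+1; lra.
exists s => //; apply: step bP _ sb; apply: le_trans sM _.
by rewrite KS; move: (K0 n) (C0 n.+1) (M0 n (K n)) (CM0 n (K n)); lra.
Qed.

(** Corrections starting at level N move the element by at most 2 * 2^-N in [q N], even in the
    limit, so for large N the limit still almost fixes [F]. *)
Lemma common_bound : exists K : nat -> R, forall (F : seq A) n d, 0 < d ->
  exists2 b, (forall k, q k b <= K k) & {in F, forall a, q n (a - mul a b) <= d}.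
Proof.
have [K [good next]] := partial_bounds.
(* One unit is the slack in [partial], the other the distance from the limit to a late term. *)
exists (fun k => K k + 2) => F n d d0.
have [B B0 BF] : exists2 B, 0 < B & {in F, forall a, q n a <= B}.
  elim: F => [|a F [B B0 BF]]; first by exists 1.
  exists (B + q n a); first by rewrite ltr_wpDr // seminorm_ge0.
  move=> x; rewrite inE => /predU1P[->|/BF xB].
    by rewrite lerDr ltW.
  by rewrite (le_trans xB) // lerDl seminorm_ge0.
(* With this N, the displacement 2 * 2^-N times [B] is below d/2; the other d/2 is the error of
   [b0]. *)
have [N nN hN] : exists2 N, (n <= N)%N & h N < d / (4 * B).
  have [N NP] := h_small (divr_gt0 d0 (mulr_gt0 (ltr0Sn R 3) B0)).
  by exists (maxn n N); rewrite ?leq_maxl ?NP ?leq_maxr.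
have [b0 b0P b0F] := good N F (d / 2) (divr_gt0 d0 (ltr0Sn _ _)).
(* To obtain a total function, the value 0 is chosen where [partial] fails; the sequence below never
   meets that case. *)
have /choice[nxt nxtP] (nb : nat * A) : exists s, partial K nb.1 nb.2 ->
    partial K nb.1.+1 s /\ q nb.1 (s - nb.2) <= h nb.1.+1.
  have [/next[s]|] := pselect (partial K nb.1 nb.2); first by exists s.
  by exists 0.
pose u := fix u m := if m is i.+1 then nxt ((N + i)%N, u i) else b0.
have uP m : partial K (N + m) (u m).
  elim: m => [|m IH]; first by rewrite addn0.
  by rewrite addnS; have [] := nxtP (_, _) IH.
have uS m : q (N + m) (u m.+1 - u m) <= h (N + m).+1.
  by have [] := nxtP (_, _) (uP m).
have [l lP] : exists l, forall n e, 0 < e -> exists m0, forall m, (m0 <= m)%N ->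
    q n (u m - l) < e.
  apply: q_lim => m; apply: le_trans (increasing_le q_leS _ (leq_addl N m)) _.
  by apply: le_trans (uS m) _; rewrite h_le // ltnS leq_addl.
exists l => [k|a aF].
  (* Taking m at least k puts [q k] among the seminorms controlled by [partial K (N + m)]. *)
  have [m0 /(_ _ (leq_maxl m0 k))] := lP k 1 ltr01; set m := maxn _ _ => um.
  have [_ /(_ k)] := uP m.
  rewrite (leq_trans (leq_maxr m0 k)) ?leq_addl // => /(_ isT) qu.
  have := seminorm_le_dist (qS k) l (u m); rewrite seminorm_distC //.
  by move: (h_gt0 (N + m)); lra.
have u0 m : q N (u m - b0) <= h N - h (N + m).
  elim: m => [|m IH]; first by rewrite addn0 !subrr seminorm0.
  have := seminorm_dist (qS N) (u m.+1) (u m) b0; rewrite addnS.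
  by move: (le_trans (increasing_le q_leS _ (leq_addr m N)) (uS m)) (hS (N + m)); lra.
have lb : q N (l - b0) <= 2 * h N.
  have [m /(_ _ (leqnn m))] := lP N (h N) (h_gt0 N).
  rewrite (seminorm_distC (qS N) (u m)).
  have := seminorm_dist (qS N) l (u m) b0.
  by move: (u0 m) (h_gt0 (N + m)); lra.
have -> : a - mul a l = (a - mul a b0) - mul a (l - b0).
  by rewrite algebra_mulBr // opprB addrA subrK.
apply: le_trans (seminormB _ _ _) _ => //.
have := le_trans (increasing_le q_leS _ (leq_trans nN (leqnSn N))) (b0F a aF).
suff : q n (mul a (l - b0)) <= d / 2 by lra.
apply: le_trans (qM _ _ _) _.
apply: le_trans (ler_pM _ _ (BF a aF) (le_trans (increasing_le q_leS _ nN) lb)) _.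
- exact: seminorm_ge0.
- exact: seminorm_ge0.
have : B * h N < B * (d / (4 * B)) by rewrite ltr_pM2l.
have -> : B * (d / (4 * B)) = d / 4 by field; rewrite gt_eqF.
lra.
Qed.

End CommonBound.

(** * The net indexed by finite lists and levels *)

Theorem theorem8p3 (R : realType) (A : tvsType R[i]) (mul : A -> A -> A)
  (hA : frechet_arens_michael mul)
  (hq : quasinormable A)
  (hb : right_locally_bounded_approximate_identity mul) :
  right_bounded_approximate_identity mul.
Proof.
have [q [qc q_leS q_basis q_lift]] := quasinormable_basis hA hq.
have [[hF law _] [P [_ _ PG]]] := hA.
have qS n := css_seminorm (qc n).
have [K KP] := common_bound law qS (fun n => css_submult (qc n)) q_leS q_lift
  (approx_unit_basis qc law hb) (geometric_limit qc q_leS q_basis hF).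
have h_gt0 n : (0 : R) < 2^-1 ^+ n by rewrite exprn_gt0.
(* The level serves both as the index of the seminorm and as the exponent of the tolerance, while
   the bound [K] is the same for all indices. *)
pose e (i : seq A * nat) := s2val (cid2 (KP i.1 i.2 _ (h_gt0 i.2))).
have eK i k : q k (e i) <= K k.
  exact: (s2valP (cid2 (KP i.1 i.2 _ (h_gt0 i.2)))).
have eF i : {in i.1, forall a, q i.2 (a - mul a (e i)) <= 2^-1 ^+ i.2}.
  exact: (s2valP' (cid2 (KP i.1 i.2 _ (h_gt0 i.2)))).
exists (seq A * nat)%type, (fun i j => {subset i.1 <= j.1} /\ (i.2 <= j.2)%N), e.
split.
- split=> [|i|i j k [ij1 ij2] [jk1 jk2]|i j].
  + by exists ([::], 0).
  + by split.
  + by split=> [x /ij1/jk1|]; rewrite ?(leq_trans ij2).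
  + exists (i.1 ++ j.1, maxn i.2 j.2); split; rewrite /= ?leq_maxl ?leq_maxr //.
      by move=> x xi; rewrite mem_cat xi.
    by move=> x xj; rewrite mem_cat xj orbT.
- by apply: (vn_bounded_basis qc q_basis) => _ k [i _ <-].
- move=> a U /(nbhs_translate PG)/q_basis[n [d d0 dU]].
  have [N _ NP] := near_infty_natSinv_expn_lt (PosNum d0).
  (* Beyond [n] the seminorm dominates [q n]; beyond [N] the tolerance is below [d]. *)
  exists ([:: a], maxn n N) => // j /= [aj]; rewrite geq_max => /andP[nj Nj].
  rewrite -[mul a (e j)](subrK a) addrC; apply: dU => /=.
  rewrite (seminorm_distC (qS n)); apply: le_lt_trans (increasing_le q_leS _ nj) _.
  apply: le_lt_trans (eF j a _) _; first by rewrite aj ?mem_head.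
  by have := NP _ Nj; rewrite /= exprVn div1r.
Qed.
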